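(* For every $k\ge 2$: $\dim V(I_k)=3k-2$, i.e. the ideal $I_k\subset R_k$ has codimension $2$ (that is, $\dim R_k-\dim(R_k/I_k)=3k-(3k-2)=2$).
   Context: $\mathbb F$ is a field of characteristic $\neq 2$, with fixed algebraic closure $\overline{\mathbb F}$. For $k\ge 2$, $R_k$ is the polynomial ring over $\mathbb F$ in the $3k$ variables $v_{i,c}$ ($1\le i\le k$, $c=1,2,3$), and $\overline v_i=(v_{i,1},v_{i,2},v_{i,3})\in R_k^3$. Let $S=\mathrm{diag}(-1,-1,1)$ and let $a\times b=(a_2b_3-a_3b_2,\;a_3b_1-a_1b_3,\;a_1b_2-a_2b_1)$ be the cross product. Define recursively $\overline w_2=\overline v_1\times\overline v_2$ and $\overline w_j=S(\overline w_{j-1})\times\overline v_j$ for $j\ge 3$. $I_k\subset R_k$ is the ideal generated by the three components of $\overline w_k$. $V(I_k)$ is the vanishing locus of $I_k$ in $\mathbb A^{3k}(\overline{\mathbb F})$; its dimension equals the Krull dimension of $R_k/I_k$. *)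

(* Defs.v *)
From HB Require Import structures.
From mathcomp Require Export all_boot all_order all_algebra.
From mathcomp Require Export mpoly.
From mathcomp Require Export boolp classical_sets.

Set Implicit Arguments.
Unset Strict Implicit.
Unset Printing Implicit Defensive.

Import GRing.Theory.

Local Open Scope classical_set_scope.
Local Open Scope ring_scope.

Definition is_largest (P : nat -> Prop) (d : nat) : Prop :=
  P d /\ forall m, P m -> (m <= d)%N.

(* A chain of length d consists of d.+1 primes. Elements of [prime_idealr A]
   are boolean predicates, and in particular proper; in classical logic every
   prime ideal is of this form. *)
Definition has_prime_chain (A : comNzRingType) (d : nat) : Prop :=
  exists P : nat -> prime_idealr A,
    forall i, (i < d)%N -> [set` P i] `<` [set` P i.+1].

Definition krull_dim (A : comNzRingType) : nat -> Prop :=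
  is_largest (has_prime_chain A).

(* dim A - dim A/I = c, written without truncated subtraction. *)
Definition codimension (A : comNzRingType) (I : idealr A) (c : nat) : Prop :=
  exists m n : nat,
    [/\ krull_dim A m, krull_dim {ideal_quot I} n & m = (n + c)%N].

Section AlgebraicSets.

Variables (E : closedFieldType) (n : nat).

Definition zero_locus (J : set {mpoly E[n]}) : set 'rV[E]_n :=
  [set x | forall p, J p -> p.@[x ord0] = 0].

Definition zariski_closed (Z : set 'rV[E]_n) : Prop :=
  exists J : set {mpoly E[n]}, Z = zero_locus J.

Definition irreducible_closed (Z : set 'rV[E]_n) : Prop :=
  [/\ zariski_closed Z, Z !=set0 &
      forall A B, zariski_closed A -> zariski_closed B ->
        Z = A `|` B -> Z = A \/ Z = B].

(* For V Zariski closed, the sets below are exactly the irreducible closed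
   subsets of V in its induced topology. *)
Definition has_irreducible_chain (V : set 'rV[E]_n) (d : nat) : Prop :=
  exists Z : nat -> set 'rV[E]_n,
    (forall i, (i <= d)%N -> irreducible_closed (Z i) /\ Z i `<=` V) /\
    (forall i, (i < d)%N -> Z i `<` Z i.+1).

Definition algebraic_set_dim (V : set 'rV[E]_n) : nat -> Prop :=
  is_largest (has_irreducible_chain V).

End AlgebraicSets.

Section CrossProduct.

Variable A : comNzRingType.

Definition cross (a b : 'cV[A]_3) : 'cV[A]_3 :=
  let x i := a i ord0 in let y i := b i ord0 in
  \col_(c < 3) [:: x 1 * y 2 - x 2 * y 1;
                   x 2 * y 0 - x 0 * y 2;
                   x 0 * y 1 - x 1 * y 0]`_c.

Definition smx : 'M[A]_3 := diag_mx (\row_(c < 3) [:: -1; -1; 1]`_c).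

End CrossProduct.

Section IdealW.

Variables (F : fieldType) (k : nat).

Local Notation Rk := {mpoly F[k * 3]}.

(* [vbar i] is the i-th vector of variables for 1 <= i <= k; the components
   are numbered from 0. The other values of i are irrelevant. *)
Definition vbar (i : nat) : 'cV[Rk]_3 :=
  if insub i.-1 is Some i' then \col_c 'X_(mxvec_index (i' : 'I_k) c) else 0.

(* The recursion starts at j = 2; the values at 0 and 1 are irrelevant. *)
Fixpoint wbar (j : nat) : 'cV[Rk]_3 :=
  match j with
  | (_.+2 as m).+1 => cross (smx Rk *m wbar m) (vbar m.+1)
  | _ => cross (vbar 1) (vbar 2)
  end.

Definition Ik : {pred Rk} :=
  fun p => `[< exists a : 'I_3 -> Rk, p = \sum_c a c * wbar k c ord0 >].

Lemma meval_wbar0 j c : meval (fun=> 0) (wbar j c ord0) = 0.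
Proof.
have v0 i d : meval (fun=> 0) (vbar i d ord0) = 0.
  rewrite /vbar; case: insubP => [i' _ _|_]; rewrite !mxE ?meval0 //.
  by rewrite mevalXU.
have x0 a i d : meval (fun=> 0) (cross a (vbar i) d ord0) = 0.
  rewrite mxE; case: d => [[|[|[|//]]] ?] /=;
  by rewrite mevalB !mevalM /= !v0 !mulr0 subr0.
by case: j => [|[|[|j]]]; apply: x0.
Qed.

Lemma Ik_idealr : idealr_closed Ik.
Proof.
split=> [||x p q].
- by apply/asboolP; exists (fun=> 0); rewrite big1 // => c _; rewrite mul0r.
- apply/asboolP=> -[a /(congr1 (meval (fun=> 0)))].
  rewrite meval1 raddf_sum big1 /= => [/eqP|c _]; first by rewrite oner_eq0.
  by rewrite [LHS]mevalM meval_wbar0 mulr0.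
move=> /asboolP[a ->] /asboolP[b ->]; apply/asboolP.
exists (fun c => x * a c + b c); rewrite mulr_sumr -big_split /=.
by apply: eq_bigr => c _; rewrite mulrDl mulrA.
Qed.

HB.instance Definition _ := isIdealr.Build Rk Ik Ik_idealr.

Definition VIk (Fbar : closedFieldType) (iota : {rmorphism F -> Fbar}) :
    set 'rV[Fbar]_(k * 3) :=
  zero_locus [set map_mpoly iota p | p in [set` Ik]].

End IdealW.

Arguments VIk {F} k {Fbar} iota.
Arguments Ik : clear implicits.

(* Main.v *)
Require Import Defs.
From HB Require Import structures.

(** The bounds for the dimension from above and from below are independent.

    From above: let [P] be a prime ideal containing the components of the
    vector [w_k], and [K] the fraction field of the quotient by [P].  Over [K]
    a cross product vanishes only if its first argument is zero or the second
    one is a multiple of it.  For [k > 2], either [w_(k-1) = 0] in [K], and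
    induction applies to the first [k - 1] vectors while the last one adds
    three coordinates; or [v_k = t S w_(k-1)] with [t] in [K], and all
    coordinates lie in the subring generated by the [3 (k - 1)] coordinates of
    the first vectors together with [t].  The case [k = 2] is the same with
    [v_1] in place of [S w_(k-1)].  Either way [3 k - 2] elements of [K]
    generate a subring containing all the coordinates
    ([iterated_cross0_generators]).  Now [m + 1] elements of a
    ring generated by [m] elements over a field satisfy a nontrivial
    polynomial relation (there are more monomials in them than coefficients to
    kill, [polys_alg_dep]), whereas elements [x_i] of [P_(i+1)] outside
    [P_i], taken along a chain of primes, satisfy no such relation modulo
    [P_0] ([prime_chain_alg_indep]).  Hence a chain starting at [P] has length
    at most [3 k - 2] ([prime_chain_bound]).

    From below: [w_2], hence every [w_j], vanishes as soon as [v_1] is a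
    multiple of [v_2].  Substituting [s v_2] for [v_1] maps the polynomial
    ring to itself with a prime kernel containing the ideal; killing [s] and
    then the coordinates of the other vectors one at a time gives an
    increasing chain of kernels of length [1 + 3 (k - 1) = 3 k - 2].  The
    coordinates themselves, killed one at a time, give the chain of length
    [3 k] in the polynomial ring.

    Both halves pass to the zero locus.  Vanishing ideals turn a chain of
    irreducible closed sets into a chain of primes.  In the other direction
    the zero locus of the kernel of a substitution is the closure of the image
    of an affine space, which is irreducible because a nonzero polynomial over
    an algebraically closed field takes a nonzero value ([mpoly_nonzero]). *)

Set Implicit Arguments.
Unset Strict Implicit.
Unset Printing Implicit Defensive.

Import GRing.Theory.
Local Open Scope classical_set_scope.
Local Open Scope ring_scope.

(** * Algebraic dependence of polynomials *)

Lemma mpoly_rmorph_ext (R S : comNzRingType) (n : nat)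
    (f g : {rmorphism {mpoly R[n]} -> S}) :
  (forall c, f c%:MP = g c%:MP) -> (forall i, f 'X_i = g 'X_i) -> f =1 g.
Proof.
move=> fgC fgX p; rewrite [p]mpolyE !rmorph_sum; apply: eq_bigr => m _.
rewrite -mul_mpolyC !rmorphM /= fgC mpolyXE_id !rmorph_prod; congr (_ * _).
by apply: eq_bigr => i _; rewrite !rmorphXn /= fgX.
Qed.

(** A matrix with more rows than columns has a nonzero row kernel; indexing by
    finite types lets the rows and columns be exponent vectors. *)
Lemma exists_dependency (F : fieldType) (I J : finType) (a : I -> J -> F) :
  (#|J| < #|I|)%N ->
  exists c : I -> F,
    (exists i, c i != 0) /\ forall j, \sum_i c i * a i j = 0.
Proof.
move=> ltJI; pose M := \matrix_(i < #|I|, j < #|J|) a (enum_val i) (enum_val j).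
have /rowV0Pn[u /sub_kermxP uM0 u_neq0] : kermx M != 0.
  rewrite kermx_eq0 /row_free eqn_leq negb_and -!ltnNge.
  by rewrite (leq_ltn_trans (rank_leq_col M) ltJI) orbT.
exists (fun i => u ord0 (enum_rank i)); split.
  have /rV0Pn[i ui_neq0] := u_neq0.
  by exists (enum_val i); rewrite enum_valK.
move=> j; have /rowP/(_ (enum_rank j)) := uM0; rewrite !mxE => uMj0.
rewrite -[RHS]uMj0.
rewrite [RHS](reindex (@enum_rank I)) /=; last first.
  by apply: onW_bij; exact: enum_rank_bij.
by apply: eq_bigr => i _; rewrite mxE !enum_rankK.
Qed.

Lemma mdeg_msuppM (R : comNzRingType) n (p q : {mpoly R[n]}) a b :
  (forall m, m \in msupp p -> mdeg m <= a)%N ->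
  (forall m, m \in msupp q -> mdeg m <= b)%N ->
  forall m, m \in msupp (p * q) -> (mdeg m <= a + b)%N.
Proof.
move=> pa qb m /msuppM_le /allpairsP[[m1 m2] /= [m1p m2q ->]].
by rewrite mdegD leq_add ?pa ?qb.
Qed.

Lemma mdeg_msuppX (R : comNzRingType) n (p : {mpoly R[n]}) a e :
  (forall m, m \in msupp p -> mdeg m <= a)%N ->
  forall m, m \in msupp (p ^+ e) -> (mdeg m <= e * a)%N.
Proof.
move=> pa; elim: e => [m|e IHe].
  by rewrite expr0 msupp1 inE => /eqP ->; rewrite mdeg0.
by rewrite exprS mulSn; apply: mdeg_msuppM.
Qed.

Lemma mdeg_msupp_prod (R : comNzRingType) n (I : finType)
    (g : I -> {mpoly R[n]}) (b : nat) (e : I -> nat) :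
  (forall i m, m \in msupp (g i) -> mdeg m <= b)%N ->
  forall m, m \in msupp (\prod_i g i ^+ e i) -> (mdeg m <= (\sum_i e i) * b)%N.
Proof.
move=> gb; rewrite big_distrl /=.
elim/big_rec2: _ => [m|i N p _ IH].
  by rewrite msupp1 inE => /eqP ->; rewrite mdeg0.
by apply: mdeg_msuppM => // u; apply: mdeg_msuppX; apply: gb.
Qed.

(** A counting argument.  The products of powers [g i ^+ mu i] with exponents
    below [N] number [N ^ m.+1], while their degrees are bounded linearly in
    [N], so that they have at most a constant times [N ^ m] coefficients.  For
    [N] large they are linearly dependent. *)
Lemma polys_alg_dep (F : fieldType) m (g : 'I_m.+1 -> {mpoly F[m]}) :
  exists (N : nat) (c : {ffun 'I_m.+1 -> 'I_N} -> F),
    (exists mu, c mu != 0) /\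
    \sum_mu (c mu)%:MP * \prod_i g i ^+ mu i = 0.
Proof.
pose b := (\max_i msize (g i))%N.
have gb i u : u \in msupp (g i) -> (mdeg u <= b)%N.
  by move=> /msize_mdeg_lt/ltnW/leq_trans; apply; apply: leq_bigmax.
(* Degrees are below [q * N], and [N > q ^ m] gives
   [(q * N) ^ m < N ^ m.+1]. *)
pose q := (m.+1 * b).+1.
pose N := (q ^ m).+1; pose M := (q * N)%N.
pose I := {ffun 'I_m.+1 -> 'I_N}; pose J := {ffun 'I_m -> 'I_M}.
pose G (mu : I) := \prod_i g i ^+ mu i.
have suppG mu u : u \in msupp (G mu) -> forall i, (u i < M)%N.
  move=> uG i; apply: (@leq_ltn_trans (mdeg u)).
    by rewrite mdegE (bigD1 i) //= leq_addr.
  apply: leq_ltn_trans (mdeg_msupp_prod gb uG) _.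
  apply: (@leq_ltn_trans ((m.+1 * N) * b)); last first.
    by rewrite /M /q mulnAC ltn_pmul2r.
  rewrite leq_mul2r; apply/orP; right.
  rewrite -[X in (_ <= X * _)%N]card_ord -sum_nat_const.
  by apply: leq_sum => j _; apply: ltnW.
have [|c [c_neq0 cG0]] := @exists_dependency F I J
    (fun mu nu => (G mu)@_[multinom val (nu i) | i < m]).
  rewrite !card_ffun !card_ord /M expnMn [ltnRHS]expnS ltn_pmul2r //.
  by rewrite expn_gt0.
exists N, c; split=> //; apply/mpolyP => u; rewrite mcoeff0.
have [ltuM|] := boolP [forall i, u i < M]%N.
  have := cG0 [ffun i => Ordinal (forallP ltuM i)].
  have -> : [multinom val ([ffun i => Ordinal (forallP ltuM i)] i) | i < m] = u.
    by apply/mnmP => i; rewrite mnmE ffunE.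
  move=> <-; rewrite raddf_sum; apply: eq_bigr => mu _.
  by rewrite /= mcoeffCM.
rewrite negb_forall => /existsP[i geM].
rewrite raddf_sum big1 // => mu _; rewrite /= mcoeffCM.
rewrite (memN_msupp_eq0 (p := G mu)) ?mulr0 //; apply: contra geM.
by move=> /suppG.
Qed.

(** * Chains of primes and algebraic dependence *)

(** The condition of [has_prime_chain] for a given family, whose first prime
    has to be named in what follows. *)
Definition prime_chain (A : comNzRingType) (P : nat -> prime_idealr A) d :=
  forall i, (i < d)%N -> [set` P i] `<` [set` P i.+1].

(** The lexicographically least exponent is isolated by the primes of the
    chain.  Among the exponents [mu] that remain at stage [j], let [e] be the
    least value of [mu j].  The factor [x j ^+ e] is not in [P j] and can be
    cancelled; modulo [x j], which lies in [P j.+1], only the exponents with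
    [mu j = e] survive.  After the last stage a single exponent is left, and a
    nonzero constant would lie in a prime ideal. *)
Lemma prime_chain_alg_indep (F : fieldType) (A : comNzRingType)
    (f : {rmorphism F -> A}) (P : nat -> prime_idealr A) (d : nat)
    (x : 'I_d -> A) (N : nat) (c : {ffun 'I_d -> 'I_N} -> F) :
  (forall i, (i < d)%N -> {subset P i <= P i.+1}) ->
  (forall i : 'I_d, x i \in P i.+1 /\ x i \notin P i) ->
  (exists mu, c mu != 0) ->
  \sum_mu f (c mu) * \prod_i x i ^+ mu i \notin P 0%N.
Proof.
move=> Psub xP [mu0 cmu0]; apply/negP => sumP0.
(* The sum at stage [j] ranges over the surviving exponents [T] and keeps only
   the powers of [x i] with [j <= i]. *)
pose c' (T : {set {ffun 'I_d -> 'I_N}}) j :=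
  \sum_(mu in T) f (c mu) * \prod_(i < d | (j <= i)%N) x i ^+ mu i.
have /(_ d (leqnn d))[] : forall j, (j <= d)%N ->
    exists T : {set {ffun 'I_d -> 'I_N}},
    [/\ T != finset.set0, forall mu, mu \in T -> c mu != 0,
        forall mu nu, mu \in T -> nu \in T ->
          forall i : 'I_d, (i < j)%N -> mu i = nu i
      & c' T j \in P j].
  elim=> [_|j IHj ltjd].
    exists [set mu | c mu != 0]%SET; split=> //.
    - by apply/set0Pn; exists mu0; rewrite inE.
    - by move=> mu; rewrite inE.
    rewrite (_ : c' _ _ = \sum_mu f (c mu) * \prod_i x i ^+ mu i) //.
    rewrite [RHS](bigID (mem [set mu | c mu != 0]%SET)) /=.
    rewrite [X in _ = _ + X]big1 ?addr0 //.
      by move=> mu; rewrite inE negbK => /eqP ->; rewrite rmorph0 mul0r.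
  have [T [/set0Pn[mu1 mu1T] Tc Teq TP]] := IHj (ltnW ltjd).
  pose jj := Ordinal ltjd; have [xP1 xNP] := xP jj.
  pose mu2 := [arg min_(mu < mu1 in T) (mu jj : nat)].
  have [mu2T mu2min] : mu2 \in T /\ forall mu, mu \in T -> (mu2 jj <= mu jj)%N.
    by rewrite /mu2; case: arg_minnP.
  pose T' := [set mu in T | mu jj == mu2 jj]%SET.
  exists T'; split.
  - by apply/set0Pn; exists mu2; rewrite inE mu2T /=.
  - by move=> mu; rewrite inE => /andP[/Tc].
  - move=> mu nu; rewrite !inE => /andP[muT /eqP mujj] /andP[nuT /eqP nujj] i.
    rewrite ltnS leq_eqVlt => /orP[/eqP eij|]; last exact: Teq.
    by rewrite (_ : i = jj) ?mujj ?nujj //; apply: val_inj.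
  pose Q := \sum_(mu in T) f (c mu) *
      (x jj ^+ (mu jj - mu2 jj) * \prod_(i < d | (j < i)%N) x i ^+ mu i).
  have QP : Q \in P j.+1.
    apply: Psub => //; have : c' T j = x jj ^+ (mu2 jj) * Q.
      rewrite /Q big_distrr; apply: eq_bigr => mu muT /=.
      rewrite [RHS]mulrCA; congr (_ * _).
      rewrite mulrA -exprD subnKC ?mu2min //.
      rewrite (bigD1 jj) //=; congr (_ * _); apply: eq_bigl => i.
      by rewrite [RHS]ltn_neqAle andbC eq_sym.
    move=> eqc; move: TP; rewrite eqc prime_idealrM.
    case/orP=> //; elim: (nat_of_ord (mu2 jj)) => [|n IHn].
      by rewrite expr0 idealr1.
    by rewrite exprS prime_idealrM (negbTE xNP) /=.
  (* The terms of [Q] that keep a factor [x j]. *)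
  pose E := \sum_(mu in T | mu jj != mu2 jj) f (c mu) *
      (x jj ^+ (mu jj - mu2 jj) * \prod_(i < d | (j < i)%N) x i ^+ mu i).
  have EP : E \in P j.+1.
    apply: rpred_sum => mu /andP[muT ne].
    have lt2 : (0 < mu jj - mu2 jj)%N.
      by rewrite subn_gt0 ltn_neqAle eq_sym ne mu2min.
    by rewrite mulrCA -(prednK lt2) exprS -mulrA mulrC; apply: idealMr.
  rewrite (_ : c' T' _ = Q - E) ?rpredB //.
  rewrite /Q (bigID (fun mu : {ffun 'I_d -> 'I_N} => mu jj == mu2 jj)) /= addrK.
  apply: eq_big => [mu|mu]; rewrite inE // => /andP[_ /eqP ->].
  by rewrite subnn expr0 mul1r.
move=> T [/set0Pn[mu muT] Tc Teq]; rewrite /c' (big_pred1 mu); last first.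
  move=> nu /=; apply/idP/eqP => [nuT|->//]; apply/ffunP => i.
  by apply: Teq.
rewrite big1 ?mulr1; last by move=> i; rewrite leqNgt ltn_ord.
move=> cP; have := idealMr (f (c mu)^-1) cP.
by rewrite -rmorphM mulVf ?Tc // rmorph1 idealr1.
Qed.

(** [phi] realizes the quotient by the first prime, with an image inside the
    [F]-algebra generated by the [m] elements [y]; a relation between the
    polynomials [g i] that express [phi (x i)] in terms of [y] is then a
    relation between the [x i] modulo that prime. *)
Lemma prime_chain_bound (F : fieldType) (A K : comNzRingType)
    (f : {rmorphism F -> A}) (phi : {rmorphism A -> K}) (m : nat)
    (y : 'I_m -> K) (d : nat) (P : nat -> prime_idealr A) :
  prime_chain P d ->
  (forall a, phi a = 0 -> a \in P 0) ->
  (forall a, exists g : {mpoly F[m]}, phi a = mmap (phi \o f) y g) ->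
  (d <= m)%N.
Proof.
move=> chP kerP gen; rewrite leqNgt; apply/negP => ltmd.
have chm i : (i < m.+1)%N -> [set` P i] `<` [set` P i.+1].
  by move=> /leq_trans lei; apply: chP; apply: lei.
have /choice[x xP] (i : 'I_m.+1) : exists x, x \in P i.+1 /\ x \notin P i.
  have [_ /existsNP[x /not_implyP[xP /negP xNP]]] := chm i (ltn_ord i).
  by exists x.
have /choice[g gE] (i : 'I_m.+1) := gen (x i).
have [N [c [c_neq0 cg0]]] := polys_alg_dep g.
have := @prime_chain_alg_indep _ _ f P _ x N c _ xP c_neq0.
have -> : \sum_mu f (c mu) * \prod_i x i ^+ mu i \in P 0.
  apply: kerP; have /(congr1 (mmap (phi \o f) y)) := cg0.
  rewrite rmorph0 => <-; rewrite !rmorph_sum; apply: eq_bigr => mu _.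
  rewrite !rmorphM /= mmapC; congr (_ * _).
  rewrite !rmorph_prod; apply: eq_bigr => i _.
  by rewrite !rmorphXn /= -gE.
by move=> /(_ (fun i ltid => (chm i ltid).1)).
Qed.

(** * The residue field of a prime ideal *)

Section ResidueField.

Variables (A : comNzRingType) (P : prime_idealr A).

(** A copy of the quotient ring, on which units and inverses are defined by
    classical choice: they are part of the structure of an integral domain,
    over which the fraction field is formed. *)
Definition residue_ring : Type := {ideal_quot P}.

HB.instance Definition _ := GRing.ComNzRing.on residue_ring.

Let residue_unit : {pred residue_ring} := fun x => `[< exists y, y * x = 1 >].

Let residue_inv (x : residue_ring) : residue_ring :=
  if pselect (exists y, y * x = 1) is left e then projT1 (cid e) else x.

Let residue_mulVx : {in residue_unit, left_inverse 1 residue_inv *%R}.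
Proof.
move=> x /asboolP ex; rewrite /residue_inv; case: pselect => // e.
by case: cid.
Qed.

Let residue_unitPl x y : y * x = 1 -> residue_unit x.
Proof. by move=> yx1; apply/asboolP; exists y. Qed.

Let residue_inv_out : {in [predC residue_unit], residue_inv =1 id}.
Proof.
move=> x; rewrite !inE => /negP nux; rewrite /residue_inv.
by case: pselect => // e; case: nux; apply/asboolP.
Qed.

HB.instance Definition _ := GRing.ComNzRing_hasMulInverse.Build residue_ring
  residue_mulVx residue_unitPl residue_inv_out.

HB.instance Definition _ := GRing.ComUnitRing_isIntegral.Build residue_ring
  (@Quotient.rquot_IdomainAxiom A P).

Definition to_residue_ring (a : A) : residue_ring := \pi_{ideal_quot P}%qT a.

Let to_residue_ring_zmod : zmod_morphism to_residue_ring.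
Proof. exact: (rmorphB \pi_{ideal_quot P}%qT). Qed.

Let to_residue_ring_monoid : monoid_morphism to_residue_ring.
Proof.
split; first exact: (rmorph1 \pi_{ideal_quot P}%qT).
exact: (rmorphM \pi_{ideal_quot P}%qT).
Qed.

HB.instance Definition _ := GRing.isZmodMorphism.Build A residue_ring
  to_residue_ring to_residue_ring_zmod.
HB.instance Definition _ := GRing.isMonoidMorphism.Build A residue_ring
  to_residue_ring to_residue_ring_monoid.

Definition to_residue_field : {rmorphism A -> {fraction residue_ring}} :=
  (@FracField.tofrac residue_ring) \o to_residue_ring.

Lemma to_residue_field_eq0 a : (to_residue_field a == 0) = (a \in P).
Proof.
rewrite /to_residue_field /= tofrac_eq0 -[in RHS](subr0 a).
rewrite Quotient.idealrBE; congr (_ == _).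
exact: esym (rmorph0 to_residue_ring).
Qed.

End ResidueField.

(** * Iterated cross products *)

Section CrossLemmas.

Variable A : comNzRingType.
Implicit Types (a b : 'cV[A]_3) (v : nat -> 'cV[A]_3).

(** The recursion of [wbar] over an arbitrary ring and arbitrary vectors, so
    that it can be transported along ring morphisms. *)
Fixpoint iterated_cross v (j : nat) : 'cV[A]_3 :=
  match j with
  | (_.+2 as m).+1 => cross (smx A *m iterated_cross v m) (v m.+1)
  | _ => cross (v 1) (v 2)
  end.

Lemma cross_entries a b :
  (cross a b 0 0 = a 1 0 * b 2%:R 0 - a 2%:R 0 * b 1 0) *
  (cross a b 1 0 = a 2%:R 0 * b 0 0 - a 0 0 * b 2%:R 0) *
  (cross a b 2%:R 0 = a 0 0 * b 1 0 - a 1 0 * b 0 0).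
Proof. by rewrite !mxE. Qed.

Lemma forall_ord3 (Q : 'I_3 -> Prop) : Q 0 -> Q 1 -> Q 2%:R -> forall i, Q i.
Proof.
move=> Q0 Q1 Q2 [[|[|[|//]]] lti].
- by rewrite (_ : Ordinal lti = 0) //; apply: val_inj.
- by rewrite (_ : Ordinal lti = 1) //; apply: val_inj.
- by rewrite (_ : Ordinal lti = 2%:R) //; apply: val_inj.
Qed.

Lemma cV3P a b : a 0 0 = b 0 0 -> a 1 0 = b 1 0 -> a 2%:R 0 = b 2%:R 0 -> a = b.
Proof.
move=> e0 e1 e2; apply/matrixP => i j; rewrite ord1.
by move: i; apply: forall_ord3.
Qed.

Lemma cross0v b : cross 0 b = 0.
Proof. by apply: cV3P; rewrite cross_entries !mxE !mul0r subr0. Qed.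

Lemma cross_scale t b : cross (t *: b) b = 0.
Proof.
apply: cV3P; rewrite cross_entries !mxE -!mulrA -mulrBr;
  by rewrite [X in X - _]mulrC subrr mulr0.
Qed.

Lemma iterated_crossS v j :
  iterated_cross v j.+3 =
  cross (smx A *m iterated_cross v j.+2) (v j.+3).
Proof. by []. Qed.

Lemma iterated_cross_eq0 v j : cross (v 1) (v 2) = 0 -> iterated_cross v j = 0.
Proof.
move=> v12; elim: j => [|[|[|j]] IHj] //.
by rewrite iterated_crossS IHj mulmx0 cross0v.
Qed.

Lemma smx_mulE a c : (smx A *m a) c 0 = [:: -1; -1; 1]`_c * a c 0.
Proof. by rewrite mul_diag_mx !mxE. Qed.

End CrossLemmas.

Lemma map_cross (A B : comNzRingType) (f : {rmorphism A -> B}) a b :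
  map_mx f (cross a b) = cross (map_mx f a) (map_mx f b).
Proof. by apply: cV3P; rewrite mxE !cross_entries rmorphB !rmorphM /= !mxE. Qed.

Lemma map_smx (A B : comNzRingType) (f : {rmorphism A -> B}) :
  map_mx f (smx A) = smx B.
Proof.
rewrite /smx map_diag_mx; congr diag_mx; apply/rowP; apply: forall_ord3;
  by rewrite !mxE /= ?rmorphN rmorph1.
Qed.

Lemma map_iterated_cross (A B : comNzRingType) (f : {rmorphism A -> B}) v j :
  map_mx f (iterated_cross v j) = iterated_cross (fun i => map_mx f (v i)) j.
Proof.
elim: j => [|[|[|j]] IHj]; rewrite [LHS]map_cross //.
by rewrite map_mxM map_smx IHj.
Qed.

Lemma smx_mul_in (A : comNzRingType) (S : subringClosed A) (a : 'cV[A]_3) :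
  (forall c, a c 0 \in S) -> forall c, (smx A *m a) c 0 \in S.
Proof.
move=> aS c; rewrite smx_mulE rpredM //.
by move: c; apply: forall_ord3; rewrite /= ?rpredN1 ?rpred1.
Qed.

Lemma smx_sqr (A : comNzRingType) : smx A *m smx A = 1%:M.
Proof.
rewrite mulmx_diag -diag_const_mx; congr diag_mx; apply/rowP.
by apply: forall_ord3; rewrite !mxE /= ?mulrNN mulr1.
Qed.

Lemma iterated_cross_in (A : comNzRingType) (S : subringClosed A)
    (v : nat -> 'cV[A]_3) j :
  (1 < j)%N -> (forall i c, (0 < i <= j)%N -> v i c 0 \in S) ->
  forall c, iterated_cross v j c 0 \in S.
Proof.
have crossS (a b : 'cV[A]_3) : (forall c, a c 0 \in S) ->
    (forall c, b c 0 \in S) -> forall c, cross a b c 0 \in S.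
  by move=> aS bS; apply: forall_ord3; rewrite cross_entries rpredB ?rpredM.
elim: j => [|[|[|j]] IHj] // _ vS; apply: crossS => c.
- exact: vS.
- exact: vS.
- apply: smx_mul_in => c'; apply: IHj => // i c'' /andP[i_gt0 lei].
  by apply: vS; rewrite i_gt0 leqW.
- by apply: vS; rewrite leqnn.
Qed.

Lemma cross_eq0 (K : fieldType) (a b : 'cV[K]_3) :
  cross a b = 0 -> a = 0 \/ exists t, b = t *: a.
Proof.
move=> ab0; have [|/cV0Pn[c ac]] := eqVneq a 0; [by left | right].
exists (b c 0 / a c 0).
have ab i j : a i 0 * b j 0 = a j 0 * b i 0.
  have e c' : cross a b c' 0 = 0 by rewrite ab0 mxE.
  have /eqP := e 0; have /eqP := e 1; have /eqP := e 2%:R.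
  rewrite !cross_entries !subr_eq0 => /eqP e2 /eqP e1 /eqP e0.
  by move: i; apply: forall_ord3; move: j; apply: forall_ord3.
apply/matrixP => i j; rewrite ord1 mxE mulrAC -[LHS](mulfK ac).
by congr (_ / _); rewrite mulrC ab mulrC.
Qed.

(** If a cross product vanishes, then either its first argument is zero or the
    second one is a multiple of it.  In the second case the last vector
    costs only one generator, the factor, because the first argument has its
    entries in the subring generated by the previous vectors. *)
Lemma iterated_cross0_generators (K : fieldType) (v : nat -> 'cV[K]_3) k :
  (1 < k)%N -> iterated_cross v k = 0 ->
  exists2 y : seq K, size y = (3 * k - 2)%N &
    forall S : subringClosed K,
      {subset y <= S} -> forall i c, (0 < i <= k)%N -> v i c 0 \in S.
Proof.
pose entries i := [:: v i 0 0; v i 1 0; v i 2%:R 0].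
have in_entries i c : v i c 0 \in entries i.
  by move: c; apply: forall_ord3; rewrite !inE eqxx ?orbT.
have eq_size j : ((3 * j).+1 = 3 * j.+1 - 2)%N.
  by rewrite mulnS addnC -addnBA // addn1.
have scaled j t b : v j.+1 = t *: b ->
    (forall S : subringClosed K,
      (forall i c, (0 < i <= j)%N -> v i c 0 \in S) ->
      forall c, b c 0 \in S) ->
    exists2 y : seq K, size y = (3 * j.+1 - 2)%N &
      forall S : subringClosed K,
        {subset y <= S} -> forall i c, (0 < i <= j.+1)%N -> v i c 0 \in S.
  move=> vj bS; exists (t :: flatten [seq entries i | i <- iota 1 j]).
    rewrite -eq_size /= size_flatten /shape -map_comp; congr _.+1.
    rewrite sumnE big_map (eq_bigr (fun=> 3)) // big_const_seq.
    by rewrite count_predT size_iota iter_addn_0.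
  move=> S yS; have vS i c : (0 < i <= j)%N -> v i c 0 \in S.
    move=> lei; apply: yS; rewrite inE; apply/orP; right.
    by apply/flatten_mapP; exists i; rewrite ?mem_iota ?add1n.
  move=> i c /andP[i_gt0]; rewrite leq_eqVlt => /orP[/eqP ->|lei].
    by rewrite vj mxE rpredM ?(bS S) // yS ?mem_head.
  by apply: vS; rewrite i_gt0.
elim: k => [|[|[|k]] IHk] // _.
  case/cross_eq0 => [v10|[t v2]]; last first.
    by apply: (scaled 1%N t (v 1%N)) => // S vS c; apply: vS.
  (* Three generators suffice here; [0] fills the list up to [3 * 2 - 2]. *)
  exists (0 :: entries 2%N) => // S yS [|[|[|i]]] // c _.
    by rewrite v10 mxE rpred0.
  by apply: yS; rewrite inE in_entries orbT.
rewrite iterated_crossS => /cross_eq0[w0|[t vk]]; last first.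
  apply: (scaled k.+2 t (smx K *m iterated_cross v k.+2)) => // S vS c.
  by apply: smx_mul_in; apply: iterated_cross_in.
have [||y szy yS] := IHk => //.
  (* [smx K] is an involution. *)
  have /(congr1 (mulmx (smx K))) := w0.
  by rewrite mulmx0 mulmxA smx_sqr mul1mx.
exists (y ++ entries k.+3).
  by rewrite size_cat szy /= -!eq_size [in RHS]mulnS addSn addnC.
move=> S yeS i c /andP[i_gt0]; rewrite leq_eqVlt => /orP[/eqP ->|lei].
  by apply: yeS; rewrite mem_cat in_entries orbT.
apply: yS; rewrite ?i_gt0 // => z zy.
by apply: yeS; rewrite mem_cat zy.
Qed.

Lemma wbar_iterated_cross (F : fieldType) k j :
  wbar F k j = iterated_cross (vbar F k) j.
Proof.
(* Stating the recursion beforehand keeps the conversion test from unfolding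
   both recursions down to polynomial arithmetic. *)
have wbarS i : wbar F k i.+3 =
    cross (smx _ *m wbar F k i.+2) (vbar F k i.+3) := erefl.
elim: j => [|[|[|j]] IHj]; [exact: erefl..|].
by rewrite wbarS IHj iterated_crossS.
Qed.

Lemma vbarS (F : fieldType) k (i : 'I_k) c :
  vbar F k i.+1 c ord0 = 'X_(mxvec_index i c).
Proof. by rewrite /vbar /= valK mxE. Qed.

(** * Upper bounds for chains of primes *)

(** Applied to an evaluation of polynomials, the image is the subalgebra
    generated by the values of the variables. *)
Section RingMorphismImage.

Variables (A B : pzRingType) (f : {rmorphism A -> B}).

Definition rmorph_image : {pred B} := fun b => `[< exists a, b = f a >].

Lemma rmorph_image_subring : subring_closed rmorph_image.
Proof.
split=> [|_ _ /asboolP[a ->] /asboolP[b ->]|_ _ /asboolP[a ->] /asboolP[b ->]].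
- by apply/asboolP; exists 1; rewrite rmorph1.
- by apply/asboolP; exists (a - b); rewrite rmorphB.
- by apply/asboolP; exists (a * b); rewrite rmorphM.
Qed.

HB.instance Definition _ :=
  GRing.isSubringClosed.Build B rmorph_image rmorph_image_subring.

End RingMorphismImage.

Lemma rmorph_mpoly_in (R B : comNzRingType) n
    (f : {rmorphism {mpoly R[n]} -> B}) (S : subringClosed B) :
  (forall c, f c%:MP \in S) -> (forall i, f 'X_i \in S) -> forall p, f p \in S.
Proof.
move=> SC SX p; rewrite [p]mpolyE rmorph_sum rpred_sum // => m _.
rewrite -mul_mpolyC rmorphM rpredM //= mpolyXE_id rmorph_prod rpred_prod //.
by move=> i _; rewrite rmorphXn rpredX.
Qed.

Lemma prime_chain_mpoly_bound (F : fieldType) n d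
    (P : nat -> prime_idealr {mpoly F[n]}) : prime_chain P d -> (d <= n)%N.
Proof.
move=> chP; apply: (@prime_chain_bound F _ _ (@mpolyC n F) idfun _
    (fun i => 'X_i) d P) => // [a /= ->|a]; first exact: idealr0.
exists a; apply: (@mpoly_rmorph_ext _ _ _ idfun) => [c|i] /=.
  by rewrite mmapC.
by rewrite mmapX mmap1U.
Qed.

Lemma prime_chain_Ik_bound (F : fieldType) k d
    (P : nat -> prime_idealr {mpoly F[k * 3]}) : (1 < k)%N -> prime_chain P d ->
  (forall c, wbar F k k c ord0 \in P 0%N) -> (d <= 3 * k - 2)%N.
Proof.
move=> k_gt1 chP wP; pose phi := to_residue_field (P 0%N).
pose v i := map_mx phi (vbar F k i).
have w0 : iterated_cross v k = 0.
  rewrite -map_iterated_cross -wbar_iterated_cross; apply/matrixP => i j.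
  by rewrite ord1 !mxE; apply/eqP; rewrite to_residue_field_eq0.
have [y szy yS] := iterated_cross0_generators k_gt1 w0.
apply: (@prime_chain_bound F _ _ (@mpolyC _ F) phi _
    (fun i : 'I_(3 * k - 2) => y`_i) d P) => // [a /eqP|a].
  by rewrite to_residue_field_eq0.
apply/asboolP; set h := phi \o _; set yy := fun i : 'I__ => _.
have yyi (i : 'I_(3 * k - 2)) : y`_i = mmap h yy 'X_i.
  by rewrite /= mmapX mmap1U.
apply: (@rmorph_mpoly_in _ _ _ phi (rmorph_image (mmap h yy))) => [c|i].
  by apply/asboolP; exists c%:MP; rewrite /= mmapC.
case/mxvec_indexP: i => i c; rewrite -vbarS.
have := yS (rmorph_image (mmap h yy)) _ i.+1 c; rewrite mxE.
apply; last exact: ltn_ord.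
move=> z /(nthP 0)[j ltj <-]; rewrite szy in ltj; apply/asboolP.
by exists 'X_(Ordinal ltj); exact: (yyi (Ordinal ltj)).
Qed.

(** * Prime ideals of quotient rings and kernels *)

Definition prime_of (A : comNzRingType) (S : {pred A})
    (idl : idealr_closed S) (prm : prime_idealr_closed S) : prime_idealr A :=
  HB.pack_for (prime_idealr A) S (isIdealr.Build A S idl)
    (isPrimeIdealrClosed.Build A S prm).

Lemma contraction_exists (A B : comNzRingType) (f : {rmorphism A -> B})
    (Q : prime_idealr B) :
  exists P : prime_idealr A, forall a, (a \in P) = (f a \in Q).
Proof.
have idl : idealr_closed (fun a => f a \in Q).
  split=> [||a u v uQ vQ]; rewrite unfold_in /=.
  - by rewrite rmorph0 idealr0.
  - by rewrite rmorph1 idealr1.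
  - by rewrite rmorphD rmorphM rpredD // idealMr.
have prm : prime_idealr_closed (fun a => f a \in Q).
  move=> u v; rewrite [_ \in _]unfold_in rmorphM => uvQ.
  by have := prime_idealrM Q (f u) (f v); rewrite uvQ => /esym.
by exists (prime_of idl prm).
Qed.

Lemma kernel_exists (A : comNzRingType) (D : idomainType)
    (f : {rmorphism A -> D}) :
  exists P : prime_idealr A, forall a, (a \in P) = (f a == 0).
Proof.
have idl : idealr_closed (fun a => f a == 0).
  split=> [||a u v /eqP u0 /eqP v0]; rewrite unfold_in /=.
  - by rewrite rmorph0.
  - by rewrite rmorph1 oner_eq0.
  - by rewrite rmorphD rmorphM u0 v0 mulr0 addr0.
have prm : prime_idealr_closed (fun a => f a == 0).
  by move=> u v; rewrite unfold_in rmorphM mulf_eq0.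
by exists (prime_of idl prm).
Qed.

(** As [P] contains [I], membership of a class is that of any of its
    representatives. *)
Lemma quotient_prime_exists (A : comNzRingType) (I : idealr A)
    (P : prime_idealr A) :
  {subset I <= P} ->
  exists Q : prime_idealr {ideal_quot I},
    forall a, (\pi_{ideal_quot I}%qT a \in Q) = (a \in P).
Proof.
move=> subIP; pose S : {pred {ideal_quot I}} := fun x => repr x \in P.
have SE a : (\pi_{ideal_quot I}%qT a \in S) = (a \in P).
  have e : repr (\pi_{ideal_quot I}%qT a) - a \in P.
    by apply: subIP; rewrite Quotient.idealrBE reprK.
  by rewrite [LHS]unfold_in /S -[repr _](subrK a) rpredDl.
have pi0 := rmorph0 \pi_{ideal_quot I}%qT.
have pi1 := rmorph1 \pi_{ideal_quot I}%qT.
have piD := rmorphD \pi_{ideal_quot I}%qT.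
have piM := rmorphM \pi_{ideal_quot I}%qT.
have idl : idealr_closed S.
  split=> [||a u v].
  - by rewrite -pi0 SE idealr0.
  - by rewrite -pi1 SE idealr1.
  - rewrite -[a]reprK -[u]reprK -[v]reprK -piM -piD !SE => uP vP.
    by rewrite rpredD // idealMr.
have prm : prime_idealr_closed S.
  by move=> u v; rewrite -[u]reprK -[v]reprK -piM !SE prime_idealrM.
by exists (prime_of idl prm).
Qed.

Lemma has_prime_chain_quot (A : comNzRingType) (I : idealr A) d :
  has_prime_chain {ideal_quot I} d <->
  exists2 P : nat -> prime_idealr A, prime_chain P d & {subset I <= P 0%N}.
Proof.
split=> [[Q chQ]|[P chP subIP]].
  pose f : {rmorphism A -> {ideal_quot I}} := \pi_{ideal_quot I}%qT.
  have /choice[P PE] i := contraction_exists f (Q i).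
  exists P; last first.
    move=> a aI; rewrite PE (_ : f a = 0) ?idealr0 //.
    rewrite -(rmorph0 f); apply/eqP.
    by rewrite -Quotient.idealrBE subr0.
  move=> i ltid; have [sub nsub] := chQ i ltid; split=> [a /=|nsubP].
    by rewrite !PE => /sub.
  by apply: nsub => x /=; rewrite -[x]reprK -!(PE _ (repr x)) => /nsubP.
(* Only the first [d.+1] primes are known to contain [I]; the chain is made
   constant from [P d] on. *)
have subIPi i : {subset I <= P (minn i d)}.
  elim: i => [|i IHi]; first by rewrite min0n.
  case: (ltnP i d) => [ltid a aI|ledi].
    have /minn_idPl -> := ltid; apply: (chP i ltid).1.
    by have /minn_idPl <- := ltnW ltid; apply: IHi.
  by move: IHi; rewrite (minn_idPr ledi) (minn_idPr (leqW ledi)).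
have /choice[Q QE] i := quotient_prime_exists (subIPi i).
exists Q => i ltid; have [sub nsub] := chP i ltid.
have [ei ei1] := (minn_idPl (ltnW ltid), minn_idPl ltid).
split=> [x /=|nsubQ]; first by rewrite -[x]reprK !QE ei ei1 => /sub.
apply: nsub => a /= aP; have := nsubQ (\pi_{ideal_quot I}%qT a).
by rewrite /= !QE ei ei1; apply.
Qed.

(** * Degenerating a parametrization *)

Definition subst_mpoly (F : fieldType) n (g : 'I_n -> {mpoly F[n]}) :
    {rmorphism {mpoly F[n]} -> {mpoly F[n]}} := mmap (@mpolyC n F) g.

Definition kill (F : fieldType) n (T : seq 'I_n) :
    {rmorphism {mpoly F[n]} -> {mpoly F[n]}} :=
  subst_mpoly (fun i => if i \in T then 0 else 'X_i).

Arguments kill {F n} T.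

Lemma subst_mpolyC (F : fieldType) n (g : 'I_n -> {mpoly F[n]}) c :
  subst_mpoly g c%:MP = c%:MP.
Proof. by rewrite /subst_mpoly /= mmapC. Qed.

Lemma subst_mpolyX (F : fieldType) n (g : 'I_n -> {mpoly F[n]}) i :
  subst_mpoly g 'X_i = g i.
Proof. by rewrite /subst_mpoly /= mmapX mmap1U. Qed.

Lemma kill_kill (F : fieldType) n (T T' : seq 'I_n) (p : {mpoly F[n]}) :
  {subset T <= T'} -> kill T' (kill T p) = kill T' p.
Proof.
move=> subT.
apply: (@mpoly_rmorph_ext _ _ _ (kill T' \o kill T) (kill T')) => [c|i] /=.
  by rewrite /kill !subst_mpolyC.
rewrite /kill !subst_mpolyX; case: ifP => [/subT ->|_].
  by rewrite rmorph0.
by rewrite subst_mpolyX.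
Qed.

(** The kernels of these substitutions increase with [j]: a further variable
    of the parametrization [g] is set to zero at each step, in the order given
    by [e]. *)
Definition degeneration (F : fieldType) n (g : 'I_n -> {mpoly F[n]})
    (e : seq 'I_n) (j : nat) : {rmorphism {mpoly F[n]} -> {mpoly F[n]}} :=
  kill (take j e) \o subst_mpoly g.

Lemma degenerationC (F : fieldType) n (g : 'I_n -> {mpoly F[n]}) e j c :
  degeneration g e j c%:MP = c%:MP.
Proof. by rewrite /degeneration /= /kill !subst_mpolyC. Qed.

Lemma degenerationX (F : fieldType) n (g : 'I_n -> {mpoly F[n]}) e j i :
  degeneration g e j 'X_i = kill (take j e) (g i).
Proof. by rewrite /degeneration /= /kill !subst_mpolyX. Qed.

Lemma degeneration_sub (F : fieldType) n (g : 'I_n -> {mpoly F[n]}) e i j p :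
  (i <= j)%N -> degeneration g e i p = 0 -> degeneration g e j p = 0.
Proof.
move=> leij dip0; rewrite /degeneration /= -(@kill_kill _ _ (take i e)).
  by rewrite [kill (take i e) _]dip0 rmorph0.
by move=> x; rewrite -(take_takel e leij) => /mem_take.
Qed.

(** Some coordinate of the parametrized set dies at each step, so that the
    inclusions of kernels are strict. *)
Definition degenerates (F : fieldType) n (g : 'I_n -> {mpoly F[n]}) e :=
  forall j, (j < size e)%N -> exists a,
    kill (take j e) (g a) != 0 /\ kill (take j.+1 e) (g a) = 0.

Lemma degeneration_prime_chain (F : fieldType) n (g : 'I_n -> {mpoly F[n]}) e :
  degenerates g e ->
  exists2 P : nat -> prime_idealr {mpoly F[n]}, prime_chain P (size e) &
    forall p, subst_mpoly g p = 0 -> p \in P 0%N.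
Proof.
move=> dg; have /choice[P PE] j := kernel_exists (degeneration g e j).
exists P => [j ltj|p p0]; last first.
  by rewrite PE /degeneration /= p0 rmorph0.
split=> [p /=|sub].
  by rewrite !PE => /eqP pj; apply/eqP; apply: degeneration_sub pj.
have [a [aj aj1]] := dg j ltj; have := sub 'X_a.
by rewrite /= !PE !degenerationX aj1 (negbTE aj) => /(_ (eqxx _)).
Qed.

Lemma kill_X (F : fieldType) n (T : seq 'I_n) i :
  kill T 'X_i = (if i \in T then 0 else 'X_i) :> {mpoly F[n]}.
Proof. exact: subst_mpolyX. Qed.

Lemma mpolyX_neq0 (F : fieldType) n (i : 'I_n) : 'X_i != 0 :> {mpoly F[n]}.
Proof. by rewrite -msupp_eq0 msuppX. Qed.

Lemma kill_take (F : fieldType) n (e : seq 'I_n) j x0 :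
  uniq e -> (j < size e)%N ->
  kill (take j e) 'X_(nth x0 e j) = 'X_(nth x0 e j) :> {mpoly F[n]} /\
  kill (take j.+1 e) 'X_(nth x0 e j) = 0 :> {mpoly F[n]}.
Proof.
move=> ue ltj; set a := nth x0 e j.
have aj : (a \in take j e) = false.
  by rewrite (in_take_leq _ (ltnW ltj)) (index_uniq x0 ltj ue) ltnn.
have aj1 : a \in take j.+1 e by rewrite (take_nth x0 ltj) mem_rcons mem_head.
by split; rewrite kill_X ?aj ?aj1.
Qed.

Lemma coordinate_degenerates (F : fieldType) n :
  degenerates (fun i => 'X_i : {mpoly F[n]}) (enum 'I_n).
Proof.
move=> j ltj; have ltjn : (j < n)%N by rewrite size_enum_ord in ltj.
have [kj kj1] := kill_take F (Ordinal ltjn) (enum_uniq 'I_n) ltj.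
by exists (nth (Ordinal ltjn) (enum 'I_n) j); rewrite kj kj1 mpolyX_neq0.
Qed.

(** * The parametrization of collinear pairs *)

Section CollinearParametrization.

Variables (F : fieldType) (k : nat).

Local Notation n := (k.+2 * 3)%N.
Local Notation var i c := ('X_(mxvec_index i c) : {mpoly F[n]}).

(** The pairs with [v_1 = s v_2].  The parameter [s] is the first coordinate of
    [v_1], a variable that is free since [v_1] is determined by [s] and
    [v_2]. *)
Definition collinear_param (a : 'I_n) : {mpoly F[n]} :=
  mxvec (\matrix_(i < k.+2, c < 3)
    if i == ord0 then var ord0 ord0 * var (lift ord0 ord0) c else var i c)
  ord0 a.

Lemma collinear_param0 c : collinear_param (mxvec_index ord0 c) =
  var ord0 ord0 * var (lift ord0 ord0) c.
Proof. by rewrite /collinear_param mxvecE mxE eqxx. Qed.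

Lemma collinear_paramS i c : collinear_param (mxvec_index (lift ord0 i) c) =
  var (lift ord0 i) c.
Proof. by rewrite /collinear_param mxvecE mxE. Qed.

Lemma collinear_param_wbar j c :
  subst_mpoly collinear_param (wbar F k.+2 j c ord0) = 0.
Proof.
pose v i := map_mx (subst_mpoly collinear_param) (vbar F k.+2 i).
have : iterated_cross v j = 0.
  apply: iterated_cross_eq0.
  rewrite (_ : v 1%N = var ord0 ord0 *: v 2%N) ?cross_scale //.
  apply/matrixP => d i; rewrite ord1 !mxE.
  rewrite (vbarS F (ord0 : 'I_k.+2)) (vbarS F (lift ord0 ord0 : 'I_k.+2)).
  by rewrite !subst_mpolyX collinear_param0 collinear_paramS.
move=> /matrixP/(_ c ord0).
by rewrite -map_iterated_cross -wbar_iterated_cross !mxE.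
Qed.

(** The factor [s] first, then the coordinates of all vectors but the first. *)
Definition collinear_order : seq 'I_n :=
  mxvec_index ord0 ord0 ::
    [seq mxvec_index (lift ord0 i) c | i <- enum 'I_k.+1, c <- enum 'I_3].

Lemma size_collinear_order : size collinear_order = (3 * k.+2 - 2)%N.
Proof.
rewrite /= size_allpairs -!cardE !card_ord.
by rewrite mulnC [in RHS]mulnS addnC -addnBA // addn1.
Qed.

Lemma mxvec_index_inj i c i' c' :
  mxvec_index i c = mxvec_index i' c' :> 'I_n -> (i, c) = (i', c').
Proof. by move=> /cast_ord_inj/enum_rank_inj. Qed.

Lemma collinear_order_uniq : uniq collinear_order.
Proof.
rewrite /= allpairs_uniq ?enum_uniq //; last first.
  move=> [i c] [i' c'] _ _ /= /mxvec_index_inj e.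
  have /= ec := congr1 snd e.
  by rewrite (lift_inj (congr1 fst e)) ec.
rewrite andbT; apply/negP => /allpairsP[[i c] /= [_ _ /mxvec_index_inj e]].
by have /eqP := congr1 fst e; rewrite (negbTE (neq_lift _ _)).
Qed.

End CollinearParametrization.

Lemma collinear_degenerates (F : fieldType) k :
  degenerates (@collinear_param F k) (collinear_order k).
Proof.
move=> [_|j ltj].
  exists (mxvec_index ord0 ord0); rewrite collinear_param0.
  split; rewrite rmorphM [kill _ 'X_(mxvec_index ord0 ord0)]kill_X.
    rewrite [kill _ _]kill_X take0 in_nil in_nil.
    by apply: mulf_neq0; apply: mpolyX_neq0.
  by rewrite /= mem_head mul0r.
pose x0 : 'I_(k.+2 * 3) := mxvec_index ord0 ord0.
have [kj kj1] := kill_take F x0 (collinear_order_uniq k) ltj.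
exists (nth x0 (collinear_order k) j.+1).
have -> : collinear_param F (nth x0 (collinear_order k) j.+1) =
    'X_(nth x0 (collinear_order k) j.+1).
  have : nth x0 (collinear_order k) j.+1 \in behead (collinear_order k).
    by rewrite -nth_behead mem_nth // size_behead -ltnS prednK.
  by move=> /allpairsP[[i c] /= [_ _ ->]]; rewrite collinear_paramS.
by rewrite kj kj1 mpolyX_neq0.
Qed.

(** * Irreducible closed sets *)

(** An algebraically closed field is infinite, and its elements are distinct
    constants of the domain of polynomials, where [p] has finitely many
    roots. *)
Lemma closed_field_nonroot (E : closedFieldType) n (p : {poly {mpoly E[n]}}) :
  p != 0 -> exists a : E, p.[a%:MP] != 0.
Proof.
move=> p_neq0; have [s szs us] : exists2 s : seq E, size s = size p & uniq s.
  elim: (size p) => [|N [s szs us]]; first by exists [::].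
  (* A root of [q + 1] is none of the elements of [s]; the extra factor for [0]
     keeps [q + 1] nonconstant when [s] is empty. *)
  pose q := \prod_(z <- 0 :: s) ('X - z%:P).
  have szq : size (q + 1) = N.+2.
    by rewrite size_polyDl size_prod_XsubC ?size_poly1 /= szs.
  have /closed_rootP[x /rootP] : size (q + 1) != 1 by rewrite szq.
  rewrite hornerD hornerC => qx; exists (x :: s); rewrite /= ?szs // us andbT.
  apply/negP => xs; have : root q x by rewrite root_prod_XsubC inE xs orbT.
  by move=> /rootP q0; move: qx; rewrite q0 add0r => /eqP; rewrite oner_eq0.
apply: contrapT => /forallNP p0.
have := @max_poly_roots _ p [seq a%:MP | a <- s].
rewrite size_map szs ltnn => H; apply/notF/H => //.
  by apply/allP => _ /mapP[a _ ->]; apply/negPn/negP => /p0.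
by rewrite map_inj_uniq //; apply: (can_inj (@mpolyCK _ _)).
Qed.

(** The variables are replaced by constants one at a time.  Seen as a
    univariate polynomial in the variable to be replaced, a nonzero polynomial
    remains nonzero at some constant. *)
Lemma mpoly_nonzero (E : closedFieldType) n (p : {mpoly E[n]}) :
  p != 0 -> exists v, p.@[v] != 0.
Proof.
move=> p_neq0.
pose h (a : nat -> E) j (i : 'I_n) : {mpoly E[n]} :=
  if (i < j)%N then (a i)%:MP else 'X_i.
have /(_ n (leqnn n))[a] : forall j, (j <= n)%N ->
    exists a, mmap (@mpolyC n E) (h a j) p != 0.
  elim=> [_|j IHj ltjn].
    exists (fun=> 0).
    suff -> : mmap (@mpolyC n E) (h (fun=> 0) 0%N) p = p by [].
    apply: (@mpoly_rmorph_ext _ _ _ (mmap _ _) idfun) => [c|i] /=.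
      by rewrite mmapC.
    by rewrite mmapX mmap1U.
  have [a pa] := IHj (ltnW ltjn).
  (* [q] is the polynomial of the previous stage with the variable of index [j]
     separated out as the univariate indeterminate. *)
  pose g (i : 'I_n) : {poly {mpoly E[n]}} :=
    if i == j :> nat then 'X else (h a j i)%:P.
  pose q := mmap (@polyC _ \o @mpolyC n E) g p.
  have qE r (h' : 'I_n -> {mpoly E[n]}) : (forall i, (g i).[r] = h' i) ->
      q.[r] = mmap (@mpolyC n E) h' p.
    move=> gh; rewrite /q.
    pose f := horner_eval r \o mmap (@polyC _ \o @mpolyC n E) g.
    apply: (@mpoly_rmorph_ext _ _ _ f (mmap (@mpolyC n E) h')) => [c|i] /=.
      by rewrite !mmapC /= horner_evalE hornerC.
    by rewrite !mmapX !mmap1U horner_evalE gh.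
  have [b qb] : exists b : E, q.[b%:MP] != 0.
    apply: closed_field_nonroot; apply: contra_neq pa => q0.
    rewrite -(@qE 'X_(Ordinal ltjn)) ?q0 ?horner0 // => i; rewrite /g.
    case: eqP => [eij|_]; last by rewrite hornerC.
    by rewrite hornerX /h eij ltnn; congr 'X_ _; apply: val_inj.
  exists (fun i => if i == j then b else a i).
  rewrite -(@qE b%:MP) // => i; rewrite /g /h ltnS [(i <= j)%N]leq_eqVlt.
  by case: eqP => _; rewrite ?hornerX ?hornerC.
move=> pa; exists (fun i => a i); apply: contra_neq pa => pa0.
rewrite -[RHS](mpolyC0 n) -pa0.
apply: (@mpoly_rmorph_ext _ _ _ (mmap (@mpolyC n E) (h a n))
  (@mpolyC n E \o meval (fun i : 'I_n => a i))) => [c|i] /=.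
  by rewrite mmapC mevalC.
by rewrite mmapX mmap1U mevalXU /h ltn_ord.
Qed.

Section ParametrizedSets.

Variables (E : closedFieldType) (n m : nat).
Variable phi : {rmorphism {mpoly E[n]} -> {mpoly E[m]}}.
Hypothesis phiC : forall c, phi c%:MP = c%:MP.

(** The Zariski closure of the image of [param_point], the map of affine spaces
    with comorphism [phi]. *)
Definition param_closure : set 'rV[E]_n := zero_locus [set p | phi p = 0].

Definition param_point (u : 'I_m -> E) : 'rV[E]_n := \row_i (phi 'X_i).@[u].

Lemma meval_param_point u p : p.@[param_point u ord0] = (phi p).@[u].
Proof.
apply: (@mpoly_rmorph_ext _ _ _ (meval _) (meval u \o phi)) => [c|i] /=.
  by rewrite phiC !mevalC.
by rewrite mevalXU mxE.
Qed.

Lemma param_point_closure u : param_closure (param_point u).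
Proof. by move=> p /= p0; rewrite meval_param_point p0 meval0. Qed.

(** If two closed sets cover the closure and neither contains it, then each has
    an equation with nonzero pullback under [phi].  The product of the two
    pullbacks is nonzero at some point of the affine space, whose image then
    lies on neither closed set. *)
Lemma param_closure_irreducible : irreducible_closed param_closure.
Proof.
split; first by exists [set p | phi p = 0].
  by exists (param_point (fun=> 0)); apply: param_point_closure.
move=> _ _ [J1 ->] [J2 ->] ZE; apply: contrapT => /not_orP[neq1 neq2].
have witness J : zero_locus J `<=` param_closure ->
    param_closure <> zero_locus J -> exists2 p, J p & phi p != 0.
  move=> sub neq; apply: contrapT => /forall2NP Jp; apply: neq.
  apply/seteqP; split=> // x Zx p Jpp; apply: Zx => /=; apply/eqP.
  by have [//|/negP] := Jp p; rewrite negbK.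
have [|p J1p p_neq0] := witness J1 _ neq1; first by rewrite ZE => x; left.
have [|q J2q q_neq0] := witness J2 _ neq2; first by rewrite ZE => x; right.
have [u] := mpoly_nonzero (mulf_neq0 p_neq0 q_neq0).
rewrite mevalM -!meval_param_point mulf_eq0 => /norP[pu qu].
have := param_point_closure u; rewrite ZE => -[] /= H.
  by rewrite (H p J1p) eqxx in pu.
by rewrite (H q J2q) eqxx in qu.
Qed.

End ParametrizedSets.

Lemma degeneration_irreducible_chain (E : closedFieldType) n
    (g : 'I_n -> {mpoly E[n]}) e (V : set 'rV[E]_n) :
  degenerates g e ->
  zero_locus [set p | subst_mpoly g p = 0] `<=` V ->
  has_irreducible_chain V (size e).
Proof.
move=> dg subV; exists (fun i => param_closure (degeneration g e (size e - i))).
split=> i lei.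
  split; first by apply: param_closure_irreducible => c; apply: degenerationC.
  move=> x Zx; apply: subV => p /= p0; apply: Zx => /=.
  by rewrite /degeneration /= p0 rmorph0.
have ltd : (size e - i.+1 < size e)%N.
  by rewrite ltn_subrL (leq_ltn_trans (leq0n i) lei).
have [a [aj aj1]] := dg _ ltd; rewrite subnSK // in aj1.
split=> [x Zx p /= p0|sub].
  by apply: Zx => /=; apply: degeneration_sub p0; rewrite leq_sub2l.
have degC j c : degeneration g e j c%:MP = c%:MP by apply: degenerationC.
have [u] := mpoly_nonzero aj; rewrite -degenerationX -meval_param_point //.
move=> /eqP; apply; apply: (sub _ (param_point_closure (degC _) u)).
by rewrite -degenerationX in aj1.
Qed.

Section VanishingIdeal.

Variables (E : closedFieldType) (n : nat).

Definition vanishing (Z : set 'rV[E]_n) : set {mpoly E[n]} :=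
  [set p | forall x, Z x -> p.@[x ord0] = 0].

Lemma zero_locus_vanishing Z : zariski_closed Z -> zero_locus (vanishing Z) = Z.
Proof.
move=> [J ->]; apply/seteqP; split=> x Zx p; last by apply.
by move=> Jp; apply: Zx => y; apply.
Qed.

(** If a product [u * v] vanishes on [Z], then [Z] is the union of its
    intersections with the zero loci of [u] and [v], and equals one of them. *)
Lemma vanishing_prime_exists Z : irreducible_closed Z ->
  exists P : prime_idealr {mpoly E[n]}, [set` P] = vanishing Z.
Proof.
move=> [[J ZJ] [x0 Zx0] irr].
pose S : {pred {mpoly E[n]}} := fun p => `[< vanishing Z p >].
have idl : idealr_closed S.
  split=> [||a u v /asboolP uZ /asboolP vZ].
  - by apply/asboolP => x _; rewrite meval0.
  - apply/asboolP => /(_ _ Zx0); rewrite meval1 => /eqP.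
    by rewrite oner_eq0.
  - apply/asboolP => x Zx.
    by rewrite mevalD mevalM (uZ x Zx) (vZ x Zx) mulr0 addr0.
have prm : prime_idealr_closed S.
  move=> u v /asboolP uvZ.
  have closedI w : zariski_closed (Z `&` zero_locus [set w]).
    exists (J `|` [set w]); rewrite ZJ; apply/seteqP; split=> x.
      by move=> [xJ xw] p [/xJ|/xw].
    by move=> xJw; split=> p pJ; apply: xJw; [left|right].
  have [] := irr _ _ (closedI u) (closedI v).
  - apply/seteqP; split=> [x Zx|x [][]//].
    have /eqP := uvZ x Zx; rewrite mevalM mulf_eq0.
    by case/orP => /eqP e; [left|right]; split=> // _ ->.
  - move=> Zu; apply/orP; left; apply/asboolP => x.
    by rewrite Zu => -[_]; apply.
  - move=> Zv; apply/orP; right; apply/asboolP => x.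
    by rewrite Zv => -[_]; apply.
exists (prime_of idl prm); apply/seteqP; split=> p /=.
  by move=> /asboolP.
by move=> pZ; apply/asboolP.
Qed.

(** Vanishing ideals reverse inclusions, and keep them strict because a closed
    set is recovered from its vanishing ideal. *)
Lemma irreducible_chain_primes (J : set {mpoly E[n]}) d :
  has_irreducible_chain (zero_locus J) d ->
  exists2 P : nat -> prime_idealr {mpoly E[n]}, prime_chain P d &
    J `<=` [set` P 0%N].
Proof.
move=> [Z [Zirr Zlt]].
have /choice[P PE] i :=
  vanishing_prime_exists (Zirr (d - i)%N (leq_subr i d)).1.
exists P => [i ltid|]; rewrite ?PE; last first.
  rewrite subn0 => p Jp x Zx; have := (Zirr d (leqnn d)).2 x Zx; exact.
have := Zlt (d - i.+1)%N; rewrite subnSK // leq_subr => /(_ isT)[sub nsub].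
split=> [p pZ x Zx|subZ]; first exact/pZ/sub.
apply: nsub; rewrite -[Z (d - i.+1)%N]zero_locus_vanishing; last first.
  by case: (Zirr _ (leq_subr i.+1 d)) => -[].
by move=> x Zx p /subZ; apply.
Qed.

End VanishingIdeal.

(** * The ideal and its zero locus *)

Lemma map_wbar (F E : fieldType) (iota : {rmorphism F -> E}) k j c :
  map_mpoly iota (wbar F k j c ord0) = wbar E k j c ord0.
Proof.
have /matrixP/(_ c ord0) := map_iterated_cross (map_mpoly iota) (vbar F k) j.
rewrite mxE -wbar_iterated_cross => ->; rewrite wbar_iterated_cross.
congr (iterated_cross _ j _ _).
apply/funext => i; apply/matrixP => d l; rewrite mxE /vbar.
by case: insubP => [i' _ _|_]; rewrite !mxE ?rmorph0 //= map_mpolyX.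
Qed.

Lemma wbar_Ik (F : fieldType) k c : wbar F k k c ord0 \in Ik F k.
Proof.
apply/asboolP; exists (fun d => (d == c)%:R).
rewrite (bigD1 c) //= eqxx mul1r big1 ?addr0 // => d /negbTE ->.
by rewrite mul0r.
Qed.

Lemma Ik_sub (F : fieldType) k (P : idealr {mpoly F[k * 3]}) :
  (forall c, wbar F k k c ord0 \in P) -> {subset Ik F k <= P}.
Proof.
by move=> wP p /asboolP[a ->]; apply: rpred_sum => c _; apply: idealMr.
Qed.

(** The recursion defining [wbar] commutes with the extension of scalars, so
    the locus is cut out by the same three polynomials over the larger
    field. *)
Lemma VIk_wbar (F : fieldType) (E : closedFieldType)
    (iota : {rmorphism F -> E}) k :
  VIk k iota = zero_locus [set p | exists c, p = wbar E k k c ord0].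
Proof.
apply/seteqP; split=> x Vx p /=.
  move=> [c ->]; apply: Vx; exists (wbar F k k c ord0); last exact: map_wbar.
  exact: wbar_Ik.
move=> [q /asboolP[a ->] <-].
pose f : {rmorphism {mpoly F[k * 3]} -> E} := meval (x ord0) \o map_mpoly iota.
rewrite -[LHS]/(f _) rmorph_sum big1 // => c _.
have fw : f (wbar F k k c ord0) = 0.
  by rewrite /f /= map_wbar; apply: Vx; exists c.
by rewrite rmorphM fw mulr0.
Qed.

Theorem theorem19 (F : fieldType) (Fbar : closedFieldType)
    (iota : {rmorphism F -> Fbar}) (k : nat) :
  2%N \notin [pchar F]%R ->
  (forall x : Fbar, algebraicOver iota x) ->
  (2 <= k)%N ->
  [/\ algebraic_set_dim (VIk k iota) (3 * k - 2)%N,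
      krull_dim {ideal_quot (Ik F k)} (3 * k - 2)%N,
      krull_dim {mpoly F[k * 3]} (3 * k)%N
    & codimension (Ik F k) 2].
Proof.
move=> _ _ k_gt1.
have dim_Rk : krull_dim {mpoly F[k * 3]} (3 * k)%N.
  rewrite [(3 * k)%N]mulnC.
  split=> [|d [P]]; last exact: prime_chain_mpoly_bound.
  have [P chP _] :=
    degeneration_prime_chain (@coordinate_degenerates F (k * 3)).
  by rewrite size_enum_ord in chP; exists P.
have dim_quot : krull_dim {ideal_quot (Ik F k)} (3 * k - 2)%N.
  split=> [|d /has_prime_chain_quot[P chP subP]]; last first.
    by apply: prime_chain_Ik_bound chP _ => // c; apply/subP/wbar_Ik.
  apply/has_prime_chain_quot; case: k k_gt1 {dim_Rk} => [|[|k]] // _.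
  have [P chP kerP] := degeneration_prime_chain (@collinear_degenerates F k).
  rewrite size_collinear_order in chP; exists P => //.
  by apply: Ik_sub => c; apply/kerP/collinear_param_wbar.
split=> //; last first.
  exists (3 * k)%N, (3 * k - 2)%N.
  by rewrite subnK // (leq_trans k_gt1) // leq_pmull.
rewrite VIk_wbar; split=> [|d /irreducible_chain_primes[P chP wP]]; last first.
  by apply: prime_chain_Ik_bound chP _ => // c; apply: wP; exists c.
case: k k_gt1 {dim_Rk dim_quot} => [|[|k]] // _; rewrite -size_collinear_order.
apply: degeneration_irreducible_chain (@collinear_degenerates Fbar k) _.
by move=> x Zx p [c ->]; apply: Zx; apply: collinear_param_wbar.
Qed.
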